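(* Let $T>0$ and $\Omega=(0,T)\times(0,1)$. Let $H:[0,1]\times\mathbb{R}\to\mathbb{R}$ satisfy $H\in C^1([0,1]\times\mathbb{R})$, $D_pH\in C^1([0,1]\times\mathbb{R})$, and, for every $x\in[0,1]$, $\lim_{|p|\to\infty}H(x,p)/|p|=+\infty$ and $D_{pp}H(x,p)>0$ for all $p\in\mathbb{R}$. Let $m_0,m_T\in C^1([0,1])$ be strictly positive on $[0,1]$ with $\int_0^1 m_0\,dx=\int_0^1 m_T\,dx=1$. Consider the ranking mean-field planning problem $$\begin{cases}-u_t+H(x,u_x)=\int_0^x m(t,y)\,dy & \text{in }\Omega,\\ m_t-\big(m\,D_pH(x,u_x)\big)_x=0 & \text{in }\Omega,\\ m(0,x)=m_0(x),\quad m(T,x)=m_T(x), & x\in[0,1],\\ -m\,D_pH(x,u_x)=0 & \text{on }(0,T)\times\{0,1\}.\end{cases}$$ This problem has at most one classical solution $(u,m)\in C^2(\overline\Omega)\times C^1(\overline\Omega)$ with $m>0$ on $\overline{\Omega}$, up to an additive constant in $u$: if $(u^1,m^1)$ and $(u^2,m^2)$ are two such solutions, then $m^1=m^2$ and $u^1-u^2$ is constant.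
   Context: Points of $\Omega$ are written $(t,x)$; $D_pH$ and $D_{pp}H$ denote the first and second derivatives of $H$ in its second variable $p$. *)

(* Defs.v *)
From HB Require Import structures.
From mathcomp Require Import all_boot all_order all_algebra.
From mathcomp Require Import all_classical all_reals all_analysis.

Set Implicit Arguments.
Unset Strict Implicit.
Unset Printing Implicit Defensive.

Import Order.TTheory GRing.Theory Num.Theory.
Import numFieldNormedType.Exports.

Local Open Scope classical_set_scope.
Local Open Scope ring_scope.

(* [Ck n K f] is f \in C^n(K) in the sense usual for closures of open sets: f is
   C^n in the interior of K and all its derivatives of order at most n extend
   continuously to K.  It is meant for sets K with K contained in closure K°,
   where the extension g of a derivative is unique on K.  The values of f
   outside K are irrelevant.  In finite dimension, asking for all directions v
   at once is the same as asking for the partial derivatives. *)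
Fixpoint Ck (R : realType) (V : normedModType R) (n : nat) (K : set V)
    (f : V -> R) : Prop :=
  if n is k.+1 then
    [/\ {within K, continuous f},
        forall z, K° z -> differentiable f z &
        forall v, exists2 g, Ck k K g & forall z, K° z -> g z = 'D_v f z]
  else {within K, continuous f}.

Section Planning.
Variable R : realType.

(* Partial derivatives of a function of two real variables.  [D2 f (a, b)] is
   the derivative at b of f (a, _), so for a Hamiltonian H(x, p) the derivative
   D_p H = D2 H is meaningful also at x = 0 and x = 1. *)
Definition D1 (f : R * R -> R) (z : R * R) : R := 'D_(1, 0) f z.
Definition D2 (f : R * R -> R) (z : R * R) : R := 'D_(0, 1) f z.

Definition Omega (T : R) : set (R * R) := `]0, T[ `*` `]0, 1[.

Definition itv01 : set R := `[0, 1].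

Definition strip : set (R * R) := itv01 `*` setT.

Definition Omegabar (T : R) : set (R * R) := `[0, T] `*` itv01.

(* Value at a boundary point z of the continuous extension of g from Omega. *)
Definition trace (T : R) (g : R * R -> R) (z : R * R) : R :=
  lim (g w @[w --> within (Omega T) (nbhs z)]).

Record classical_solution (T : R) (H : R * R -> R) (m0 mT : R -> R)
    (u m : R * R -> R) : Prop := {
  sol_u_C2 : Ck 2 (Omegabar T) u;
  sol_m_C1 : Ck 1 (Omegabar T) m;
  sol_m_gt0 : forall z, Omegabar T z -> 0 < m z;
  sol_HJ : forall t x : R, Omega T (t, x) ->
    - D1 u (t, x) + H (x, D2 u (t, x)) =
      \int[lebesgue_measure]_(y in `[0, x]) m (t, y);
  sol_transport : forall t x : R, Omega T (t, x) ->
    D1 m (t, x) - D2 (fun z => m z * D2 H (z.2, D2 u z)) (t, x) = 0;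
  sol_init : forall x : R, itv01 x -> m (0, x) = m0 x;
  sol_final : forall x : R, itv01 x -> m (T, x) = mT x;
  sol_bdry : forall t x : R, t \in `]0, T[ -> x = 0 \/ x = 1 ->
    - m (t, x) * D2 H (x, trace T (D2 u) (t, x)) = 0
}.

End Planning.

Arguments itv01 {R}.
Arguments strip {R}.

(* Main.v *)
(** Lasry-Lions duality.  Write [q = m * D_p H (x, u_x)], [w (t, x)] for the
    integral of [m (t, _)] over [0, x], and a prefix [d] for the difference of
    the two solutions.  The coupling only contributes [dw * dw_x], an exact
    derivative, so that
      (du * dm)_t = (du * dq - dw ^ 2 / 2)_x - defect,
    where [defect >= 0] by convexity of [H], with equality only if the two
    [u_x] agree.  Conservation of mass gives [dw = 0] at [x = 1], so the
    bracket vanishes at [x = 0, 1]; since [dm = 0] at [t = 0, T], integrating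
    over space and time forces [defect = 0].  Then [du_x = 0], the
    Hamilton-Jacobi equation makes [dw = - du_t] independent of [x], hence
    [dm = dw_x = 0], [dw = 0] and [du_t = 0]. *)

Require Import Defs.
From mathcomp Require Import all_boot all_order all_algebra.
From mathcomp Require Import all_classical all_reals all_analysis.
From mathcomp Require Import ring.
Import Order.TTheory GRing.Theory Num.Theory.
Import numFieldNormedType.Exports.

Local Open Scope classical_set_scope.
Local Open Scope ring_scope.

Set Implicit Arguments.
Unset Strict Implicit.

(** * Continuity relative to a set *)

Lemma continuous_within_comp (T S U : topologicalType) (A : set T) (B : set S)
    (g : T -> S) (f : S -> U) :
  {within A, continuous g} -> (forall x, A x -> B (g x)) ->
  {within B, continuous f} -> {within A, continuous (f \o g)}.
Proof.
move=> /subspace_continuousP cg gAB /subspace_continuousP cf.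
apply/subspace_continuousP => x Ax.
apply: (@cvg_comp _ _ _ g f (within A (nbhs x)) (within B (nbhs (g x)))); last first.
  exact: cf (gAB _ Ax).
move=> W /= gW; rewrite /nbhs/= in gW.
have := cg x Ax _ gW; rewrite /nbhs/= /within/=.
apply: filterS => y yW Ay; apply: (yW Ay); exact: gAB.
Qed.

Lemma continuous_within_pair (T S U : topologicalType) (A : set T)
    (f : T -> S) (g : T -> U) :
  {within A, continuous f} -> {within A, continuous g} ->
  {within A, continuous (fun z => (f z, g z))}.
Proof. by move=> cf cg z; exact: cvg_pair (cf z) (cg z). Qed.

Section within_algebra.
Context {R : realType} {T : topologicalType}.
Implicit Types (A : set T) (f g : T -> R).

Lemma continuous_withinD A f g :
  {within A, continuous f} -> {within A, continuous g} ->
  {within A, continuous (fun z => f z + g z)}.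
Proof. by move=> cf cg z; apply: (continuousD (cf z) (cg z)). Qed.

Lemma continuous_withinB A f g :
  {within A, continuous f} -> {within A, continuous g} ->
  {within A, continuous (fun z => f z - g z)}.
Proof. by move=> cf cg z; apply: (continuousB (cf z) (cg z)). Qed.

Lemma continuous_withinM A f g :
  {within A, continuous f} -> {within A, continuous g} ->
  {within A, continuous (fun z => f z * g z)}.
Proof. by move=> cf cg z; apply: (continuousM (cf z) (cg z)). Qed.

End within_algebra.

(** * One-variable calculus: monotonicity and strict convexity *)

Section Monotone.
Context {R : realType}.
Implicit Types (f df : R -> R) (a b : R).

(** A nonincreasing function is squeezed between its two end values. The lemma serves both in time,
    for a space integral, and in space, for its integrand's balance. *)
Lemma nonincreasing_eq_ends a b f df :
  a < b -> {within `[a, b], continuous f} ->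
  (forall x, x \in `]a, b[ -> is_derive x 1 f (df x)) ->
  (forall x, x \in `]a, b[ -> df x <= 0) -> f a = f b ->
  (forall x, x \in `[a, b] -> f x = f a) /\
  (forall x, x \in `]a, b[ -> df x = 0).
Proof.
move=> ab cf fdf df0 fab.
have fE x : x \in `[a, b] -> f x = f a.
  rewrite in_itv/= => /andP[ax xb].
  have der y : y \in `]a, b[ -> derivable f y 1 by move=> /fdf[].
  have der0 y : y \in `]a, b[ -> derive1 f y <= 0.
    by move=> yab; rewrite derive1E; have := fdf _ yab; move=> [_ ->]; exact: df0.
  apply/eqP; rewrite eq_le; apply/andP; split.
    by apply: (ler0_derive1_le_cc der der0) => //;
      rewrite in_itv/= ?lexx ?ax ?xb ?(ltW ab).
  by rewrite fab; apply: (ler0_derive1_le_cc der der0) => //;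
      rewrite in_itv/= ?lexx ?ax ?xb ?(ltW ab).
split=> // x xab; have [_ <-] := fdf _ xab.
rewrite (near_eq_derive (g := cst (f a))) ?derive_cst//.
near=> y; rewrite fE//; apply: subset_itv_oo_cc; near: y; exact: near_in_itvoo.
Unshelve. all: by end_near. Qed.

Lemma derive0_constant a b f : {within `[a, b], continuous f} ->
  (forall x, x \in `]a, b[ -> is_derive x 1 f 0) ->
  forall x, x \in `[a, b] -> f x = f a.
Proof.
move=> cf df0 x; rewrite in_itv/= => /andP[].
rewrite le_eqVlt => /orP[/eqP <-//|ax xb].
have cx : {within `[a, x], continuous f}.
  by apply: continuous_subspaceW cf; apply: subset_itvl; rewrite bnd_simp.
have dx y : y \in `]a, x[ -> is_derive y 1 f 0.
  by move=> yax; apply: df0; apply: (subset_itvl _ yax); rewrite bnd_simp.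
have [c _ /eqP] := MVT (df := fun=> 0) ax dx cx.
by rewrite mul0r subr_eq0 => /eqP.
Qed.

(** The mean value theorem gives [G b - G a = g c * (b - a)] with c strictly between a and b. Since
    [g] is strictly increasing, [g c - g a] has the sign of [b - a], whichever of a and b is
    larger. *)
Lemma strict_convex_tangent (G g k : R -> R) :
  (forall p : R, is_derive p 1 G (g p)) ->
  (forall p : R, is_derive p 1 g (k p)) ->
  (forall p, 0 < k p) ->
  forall a b, a != b -> 0 < G b - G a - g a * (b - a).
Proof.
move=> Gg gk k0.
have cG a b : {within `[a, b], continuous G}.
  by apply: derivable_within_continuous => x _; case: (Gg x).
have cg a b : {within `[a, b], continuous g}.
  by apply: derivable_within_continuous => x _; case: (gk x).
have ginc a b : a < b -> g a < g b.
  move=> ab; have [c _ E] := MVT ab (fun x _ => gk x) (cg a b).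
  by rewrite -subr_gt0 E mulr_gt0// subr_gt0.
move=> a b; rewrite neq_lt => /orP[ab|ba].
- have [c + ->] := MVT ab (fun x _ => Gg x) (cG a b).
  rewrite in_itv/= => /andP[ac cb].
  by rewrite -mulrBl mulr_gt0// subr_gt0// ginc.
- have [c + E] := MVT ba (fun x _ => Gg x) (cG b a).
  rewrite in_itv/= => /andP[bc ca].
  rewrite -[G b - G a]opprB E -mulrN opprB -mulrBl.
  by rewrite nmulr_rgt0 ?subr_lt0// ginc.
Qed.

End Monotone.

(** * Integrals over space slices and the balance argument *)

Section Balance.
Context {R : realType}.
Local Notation mu := (@lebesgue_measure R).

Lemma integrable_continuous01 (f : R -> R) :
  {within `[0, 1], continuous f} -> mu.-integrable `[0, 1] (EFin \o f).
Proof.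
move=> cf; apply: continuous_compact_integrable => //; exact: segment_compact.
Qed.

Lemma integrable_continuous01oo (f : R -> R) :
  {within `[0, 1], continuous f} -> mu.-integrable `]0, 1[ (EFin \o f).
Proof.
move=> /integrable_continuous01; apply: integrableS => //.
exact: subset_itv_oo_cc.
Qed.

(** The endpoints are null. Differentiation under the integral uses the open interval, where time
    derivatives are known, whereas primitives use closed ones. *)
Lemma Rintegral01_oo (f : R -> R) : {within `[0, 1], continuous f} ->
  \int[mu]_(x in `]0, 1[) f x = \int[mu]_(x in `[0, 1]) f x.
Proof.
move=> cf; rewrite Rintegral_itv_obnd_cbnd; last exact: integrable_continuous01oo.
rewrite Rintegral_itv_bndo_bndc//.
apply: integrableS (integrable_continuous01 cf) => //.
by move=> x; rewrite /= !in_itv/= => /andP[-> /ltW ->].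
Qed.

Lemma continuous_primitive01 (f : R -> R) : {within `[0, 1], continuous f} ->
  {within `[0, 1], continuous (fun x => \int[mu]_(y in `[0, x]) f y)}.
Proof.
move=> /integrable_continuous01 intf.
exact: (parameterized_integral_continuous ler01 intf).
Qed.

Lemma is_derive_primitive01 (f : R -> R) (x : R) :
  {within `[0, 1], continuous f} -> x \in `]0, 1[ ->
  is_derive x 1 (fun x => \int[mu]_(y in `[0, x]) f y) (f x).
Proof.
move=> cf x01; have /andP[x0 x1] : 0 < x < 1 by move: x01; rewrite in_itv.
have cx : {for x, continuous f}.
  have [+ _ _] := (continuous_within_itvP f ltr01).1 cf.
  exact.
have [d1 d2] := continuous_FTC1_closed x1 (integrable_continuous01 cf) x0 cx.
rewrite derive1E in d2; exact: (DeriveDef d1 d2).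
Qed.

Section Slices.
Variables (T : R) (T_gt0 : 0 < T).
Implicit Types f g h k : R * R -> R.

Lemma continuous_slice_x f t : {within Omegabar T, continuous f} ->
  t \in `[0, T] -> {within `[0, 1], continuous (fun x => f (t, x))}.
Proof.
move=> cf tT; apply: (continuous_within_comp (g := fun x => (t, x)) _ _ cf).
  by apply: continuous_within_pair; apply: continuous_subspaceT => x;
    [exact: cvg_cst|exact: cvg_id].
by move=> x /= x01; split.
Qed.

Lemma continuous_slice_t f x : {within Omegabar T, continuous f} ->
  x \in `[0, 1] -> {within `[0, T], continuous (fun t => f (t, x))}.
Proof.
move=> cf tT; apply: (continuous_within_comp (g := fun t => (t, x)) _ _ cf).
  by apply: continuous_within_pair; apply: continuous_subspaceT => t;
    [exact: cvg_id|exact: cvg_cst].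
by move=> t /= t0T; split.
Qed.

Lemma continuous_bounded f : {within Omegabar T, continuous f} ->
  exists2 M, 0 <= M & forall z, Omegabar T z -> `|f z| <= M.
Proof.
move=> cf; have cK : compact (Omegabar T).
  by apply: compact_setX; exact: segment_compact.
have /compact_bounded [M [_ /(_ (`|M| + 1))]] := continuous_compact cf cK.
move=> H; exists (`|M| + 1) => [|z Kz]; first by rewrite addr_ge0.
apply: H; last by exists z.
by rewrite (le_lt_trans (ler_norm M))// ltrDl.
Qed.

(* [continuity_under_integral] works on an open interval of times, so times are
   extended past 0 and T by clamping. *)
Let clamp (t : R) := Num.max 0 (Num.min t T).

Let clampE t : t \in `[0, T] -> clamp t = t.
Proof.
rewrite in_itv/= => /andP[t0 tT]; rewrite /clamp.
by rewrite min_l// max_r.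
Qed.

Let clamp_in t : clamp t \in `[0, T].
Proof.
rewrite /clamp in_itv/= le_max lexx/= ge_max (ltW T_gt0)/=.
by rewrite ge_min lexx orbT.
Qed.

Let clamp_continuous : continuous clamp.
Proof.
move=> t; apply: (@continuous_max _ _ (cst 0) (fun t => Num.min t T)).
  exact: cvg_cst.
apply: (@continuous_min _ _ id (cst T)); [exact: cvg_id|exact: cvg_cst].
Qed.

(** Dominated convergence: the dominating constant is a bound of [f] on the compact closed
    rectangle. *)
Lemma continuous_Rintegral_slice f : {within Omegabar T, continuous f} ->
  {within `[0, T], continuous (fun t => \int[mu]_(x in `]0, 1[) f (t, x))}.
Proof.
move=> cf; have [M M0 fM] := continuous_bounded cf.
have : {in `](-1), (T + 1)[%classic, continuous
   (fun t => \int[mu]_(x in `]0, 1[) f (clamp t, x))}.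
  apply: (@continuity_under_integral _ _ _ mu (fun t x => f (clamp t, x))
    `]0, 1[ _ (-1) (T + 1) _ _ (cst M)) => //.
  - move=> t _; apply: integrable_continuous01oo.
    exact: continuous_slice_x.
  - apply: aeW => x /= x01 t _.
    have ct : {within setT, continuous (fun t => f (clamp t, x))}.
      apply: (continuous_within_comp (B := `[0, T]) (g := clamp)
        (f := fun t => f (t, x))).
      - exact: continuous_subspaceT.
      - by move=> s _; exact: clamp_in.
      - by apply: continuous_slice_t => //; exact: subset_itv_oo_cc.
    by move: ct; rewrite (continuous_open_subspace _ openT); apply; rewrite inE.
  - apply: (@integrable_continuous01oo (cst M)).
    by apply: continuous_subspaceT => x; exact: cvg_cst.
  - move=> t _; apply: aeW => x /= x01; apply: fM.
    by split => //=; exact: subset_itv_oo_cc.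
move=> c.
apply: (@subspace_eq_continuous _ _ _
  (fun t => \int[mu]_(x in `]0, 1[) f (clamp t, x))).
  by move=> t /[!inE] /clampE ->.
apply: continuous_in_subspaceT => t /[!inE] /= t0T; apply: c.
move: t0T; rewrite inE/= !in_itv/= => /andP[t0 tT]; apply/andP; split.
  by rewrite (lt_le_trans _ t0)// ltrN10.
by rewrite (le_lt_trans tT)// ltrDl.
Qed.

(** Differentiation under the integral sign, dominated by a bound of [g] on the closed rectangle. *)
Lemma is_derive_Rintegral_slice f g : {within Omegabar T, continuous f} ->
  {within Omegabar T, continuous g} ->
  (forall t x, Omega T (t, x) ->
    is_derive t 1 (fun s => f (s, x)) (g (t, x))) ->
  forall t : R, t \in `]0, T[ ->
  is_derive t 1 (fun t => \int[mu]_(x in `]0, 1[) f (t, x))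
    (\int[mu]_(x in `]0, 1[) g (t, x)).
Proof.
move=> cf cg fg t tT; have [M M0 gM] := continuous_bounded cg.
pose F (t x : R) : R := f (t, x).
have intF s : `]0, T[%classic s -> mu.-integrable `]0, 1[ (EFin \o F s).
  move=> sT; apply: integrable_continuous01oo; apply: continuous_slice_x => //.
  exact: subset_itv_oo_cc.
have dF s x : `]0, T[%classic s -> `]0, 1[%classic x -> derivable (F ^~ x) s 1.
  by move=> sT x01; have [] := fg s x (conj sT x01).
have dFE s x : `]0, T[%classic s -> `]0, 1[%classic x ->
    partial1of2 F s x = g (s, x).
  by move=> sT x01; rewrite partial1of2E; have [] := fg s x (conj sT x01).
have intM : mu.-integrable `]0, 1[ (EFin \o cst M).
  by apply: integrable_continuous01oo; apply: continuous_subspaceT => x; exact: cvg_cst.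
have FM s x : `]0, T[%classic s -> `]0, 1[%classic x ->
    `|partial1of2 F s x| <= cst M x.
  move=> sT x01; rewrite dFE//; apply: gM.
  by split; apply: subset_itv_oo_cc.
have mI : measurable (`]0, 1[%classic : set (measurableTypeR R)) by [].
have d1 := derivable_under_integral mI tT intF dF (fun _ => M0) intM FM.
have d2 := differentiation_under_integral mI tT intF dF (fun _ => M0) intM FM.
rewrite derive1E in d2; apply: (DeriveDef d1); rewrite d2.
by apply: eq_Rintegral => x /[!inE] x01; rewrite dFE.
Qed.

(** From f_t = g <= k = h_x and equal values of h at both ends, the integral of f over space is
    nonincreasing in time. It vanishes at 0 and T, hence always, and no slack is left in g <= k. The
    function k is never integrated: the monotonicity of the primitive of g minus h replaces that.
    The first conclusion will give conservation of mass, the second the vanishing of the convexity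
    defect. *)
Lemma balance_rigidity f g h k : {within Omegabar T, continuous f} ->
  {within Omegabar T, continuous g} ->
  (forall t x, Omega T (t, x) ->
    is_derive t 1 (fun s => f (s, x)) (g (t, x))) ->
  (forall t : R, t \in `]0, T[ ->
    {within `[0, 1], continuous (fun x => h (t, x))}) ->
  (forall t x, Omega T (t, x) ->
    is_derive x 1 (fun y => h (t, y)) (k (t, x))) ->
  (forall z, Omega T z -> g z <= k z) ->
  (forall t : R, t \in `]0, T[ -> h (t, 0) = h (t, 1)) ->
  (forall x : R, x \in `[0, 1] -> f (0, x) = 0 /\ f (T, x) = 0) ->
  (forall t : R, t \in `[0, T] -> \int[mu]_(x in `[0, 1]) f (t, x) = 0) /\
  (forall z, Omega T z -> g z = k z).
Proof.
move=> cf cg fg ch hk gk h01 f0T.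
(* [P t] is nonincreasing, and [P t 1 - P t 0] is the derivative at [t] of the
   integral of [f (t, _)]. *)
pose P t x := \int[mu]_(y in `[0, x]) g (t, y) - h (t, x).
have cg' (t : R) : t \in `]0, T[ ->
    {within `[0, 1], continuous (fun x => g (t, x))}.
  by move=> tT; apply: continuous_slice_x => //; exact: subset_itv_oo_cc.
have cP (t : R) : t \in `]0, T[ -> {within `[0, 1], continuous (P t)}.
  move=> tT; apply: continuous_withinB; last exact: ch.
  by apply: continuous_primitive01; exact: cg'.
have dP (t x : R) : t \in `]0, T[ -> x \in `]0, 1[ ->
    is_derive x 1 (P t) (g (t, x) - k (t, x)).
  move=> tT x01; apply: is_deriveB; last exact: hk.
  exact: (is_derive_primitive01 (cg' t tT)).
have P0 t : P t 0 = - h (t, 0) by rewrite /P set_itv1 Rintegral_set1 sub0r.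
have P1 (t : R) : t \in `]0, T[ ->
    P t 1 = \int[mu]_(x in `]0, 1[) g (t, x) - h (t, 0).
  by move=> tT; rewrite /P Rintegral01_oo ?h01//; exact: cg'.
have dP0 (t x : R) : t \in `]0, T[ -> x \in `]0, 1[ -> g (t, x) - k (t, x) <= 0.
  by move=> tT x01; rewrite subr_le0; apply: gk.
have intg0 (t : R) : t \in `]0, T[ -> \int[mu]_(x in `]0, 1[) g (t, x) <= 0.
  move=> tT; rewrite -(lerD2r (- h (t, 0))) add0r -P1// -P0.
  have derP y : y \in `]0, 1[ -> derivable (P t) y 1 by move=> /(dP t y tT)[].
  apply: (ler0_derive1_le_cc derP); rewrite ?in_itv/= ?lexx ?ler01//; last exact: cP.
  move=> y y01; rewrite derive1E; have [_ ->] := dP t y tT y01; exact: dP0.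
have f0 t : t = 0 \/ t = T -> \int[mu]_(x in `]0, 1[) f (t, x) = 0.
  move=> tE; rewrite (@eq_Rintegral _ _ _ mu _ (cst 0)) ?Rintegral_cst ?mul0r//.
  move=> x /[!inE] x01; have [] := f0T x (subset_itv_oo_cc x01).
  by case: tE => ->.
have [f1 f2] := nonincreasing_eq_ends T_gt0 (continuous_Rintegral_slice cf)
  (is_derive_Rintegral_slice cf cg fg) intg0
  (etrans (f0 0 (or_introl erefl)) (esym (f0 T (or_intror erefl)))).
split=> [t tT|[t x] [/= tT x01]].
  rewrite -Rintegral01_oo; last exact: continuous_slice_x.
  by rewrite f1// f0//; left.
(* The integral of f is constant in time, so its derivative [P t 1 - P t 0] is zero, and the
   monotonicity argument applies again, now in x. *)
have PE : P t 0 = P t 1 by rewrite P0 P1// f2// sub0r.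
have [_ /(_ _ x01)] := nonincreasing_eq_ends ltr01 (cP t tT)
  (fun x => dP t x tT) (fun x => dP0 t x tT) PE.
by move/eqP; rewrite subr_eq0 => /eqP.
Qed.
End Slices.
End Balance.

(** * The rectangle, its closure and boundary traces *)

Section Domain.
Context {R : realType}.
Variables (T : R).
Hypothesis T_gt0 : 0 < T.

(** A point below b is approached from the right, and b itself from the left. *)
Lemma closure_itvoo_mem (a b : R) : a < b -> `[a, b] `<=` closure `]a, b[%classic.
Proof.
move=> ab t; rewrite /= in_itv/= => /andP[at_ tb] A At.
have [tb'|bt] := ltP t b.
- near t^'+ => s; exists s; split; last by near: s; exact: cvg_within.
  rewrite /= in_itv/=; apply/andP; split; last by near: s; exact: nbhs_right_lt.
  by apply: (le_lt_trans at_); near: s; exact: nbhs_right_gt.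
- have at' : a < t by exact: lt_le_trans bt.
  near t^'- => s; exists s; split; last by near: s; exact: cvg_within.
  rewrite /= in_itv/=; apply/andP; split; first by near: s; exact: nbhs_left_gt.
  by apply: (lt_le_trans _ tb); near: s; exact: nbhs_left_lt.
Unshelve. all: by end_near. Qed.

Lemma nbhs_Omega z : Omega T z -> nbhs z (Omega T).
Proof.
case: z => t x [/= tT x01]; exists (`]0, T[%classic, `]0, 1[%classic) => //=.
by split; apply: near_in_itvoo.
Qed.

Lemma Omega_sub_closed z : Omega T z -> Omegabar T z.
Proof. by move=> [t x]; split; apply: subset_itv_oo_cc. Qed.

Lemma Omega_interior z : Omega T z -> (Omegabar T)° z.
Proof. by move=> /nbhs_Omega; apply: filterS; exact: Omega_sub_closed. Qed.

Lemma strip_interior (x p : R) : x \in `]0, 1[ -> (@strip R)° (x, p).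
Proof.
move=> x01; exists (`]0, 1[%classic, setT) => /=.
  by split; [exact: near_in_itvoo|exact: filterT].
by move=> [y q] [/= y01 _]; split => //; apply: subset_itv_oo_cc.
Qed.

Lemma Omegabar_closure : Omegabar T `<=` closure (Omega T).
Proof.
move=> [t x] [/= tT x01] A [[A1 A2] /= [A1t A2x] AA].
have [s [sT As]] := closure_itvoo_mem T_gt0 tT A1t.
have [y [y01 Ay]] := closure_itvoo_mem ltr01 x01 A2x.
by exists (s, y); split => //; apply: AA.
Qed.

(** Properness makes limits along [Omega T] unique, so that the [lim] in [trace] can be computed. *)
Lemma Omegabar_proper z : Omegabar T z -> ProperFilter (within (Omega T) (nbhs z)).
Proof. by move=> /Omegabar_closure; exact: within_nbhs_proper. Qed.

Lemma cvg_within_Omega (f : R * R -> R) z : {within Omegabar T, continuous f} ->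
  Omegabar T z -> f w @[w --> within (Omega T) (nbhs z)] --> f z.
Proof.
move=> /subspace_continuousP cf Kz; apply: cvg_trans (cf z Kz).
by apply: cvg_app; apply: within_subset => w; exact: Omega_sub_closed.
Qed.

Lemma trace_eq (f g : R * R -> R) z : {within Omegabar T, continuous f} ->
  (forall z, Omega T z -> f z = g z) -> Omegabar T z -> trace T g z = f z.
Proof.
move=> cf fg Kz; have := Omegabar_proper Kz => PF.
have gz : g w @[w --> within (Omega T) (nbhs z)] --> f z.
  apply: cvg_trans (cvg_within_Omega cf Kz).
  by apply: fmap_within_eq => w /[!inE] /fg ->.
by rewrite /trace; apply: (@cvg_lim R _ _ _ PF _ _ gz).
Qed.

(** Both values at z are the trace of [g] at z. *)
Lemma eq_on_Omegabar (f g : R * R -> R) : {within Omegabar T, continuous f} ->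
  {within Omegabar T, continuous g} ->
  (forall z, Omega T z -> f z = g z) -> forall z, Omegabar T z -> f z = g z.
Proof.
move=> cf cg fg z Kz; rewrite -(trace_eq cf fg Kz).
exact: (trace_eq cg (fun _ _ => erefl) Kz).
Qed.

End Domain.

(** * Partial derivatives as one-variable derivatives *)

Section Partial.
Context {R : realType}.
Implicit Types f : R * R -> R.

(** The difference quotients are equal as functions, so that derivability and the value of the
    derivative transfer together. *)
Lemma partial1_quotient f (t x : R) :
  (fun h : R => h^-1 *: ((f \o shift (t, x)) (h *: (1, 0)) - f (t, x))) =
  (fun h : R => h^-1 *: (((fun s => f (s, x)) \o shift t) (h *: (1 : R)) - f (t, x))).
Proof.
apply/funext => h /=; congr (_ *: (f _ - _)).
by congr (_, _); rewrite /= ?scaler0 ?add0r.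
Qed.

Lemma partial2_quotient f (t x : R) :
  (fun h : R => h^-1 *: ((f \o shift (t, x)) (h *: (0, 1)) - f (t, x))) =
  (fun h : R => h^-1 *: (((fun y => f (t, y)) \o shift x) (h *: (1 : R)) - f (t, x))).
Proof.
apply/funext => h /=; congr (_ *: (f _ - _)).
by congr (_, _); rewrite /= ?scaler0 ?add0r.
Qed.

Lemma is_derive_D1 f (t x : R) : derivable f (t, x) (1, 0) ->
  is_derive t 1 (fun s => f (s, x)) (D1 f (t, x)).
Proof.
move=> df; apply: DeriveDef.
  by move: df; rewrite /derivable partial1_quotient.
by rewrite /D1 /derive partial1_quotient.
Qed.

Lemma is_derive_D2 f (t x : R) : derivable f (t, x) (0, 1) ->
  is_derive x 1 (fun y => f (t, y)) (D2 f (t, x)).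
Proof.
move=> df; apply: DeriveDef.
  by move: df; rewrite /derivable partial2_quotient.
by rewrite /D2 /derive partial2_quotient.
Qed.

Lemma D2_derive f (t x : R) : D2 f (t, x) = 'D_1 (fun y => f (t, y)) x.
Proof. by rewrite /D2 /derive partial2_quotient. Qed.

End Partial.

(** * From classical solutions to slice-wise equations *)

Section Solution.
Context {R : realType}.
Local Notation mu := (@lebesgue_measure R).
Variables (T : R) (H : R * R -> R).
Hypothesis T_gt0 : 0 < T.
Hypothesis H_C1 : Ck 1 strip H.
Hypothesis DpH_C1 : Ck 1 strip (D2 H).
Hypothesis DppH_gt0 :
  forall x : R, itv01 x -> forall p : R, 0 < D2 (D2 H) (x, p).

(** Here x stays in the open interval because [Ck] gives differentiability only in the interior of
    the strip. *)
Lemma Hamiltonian_tangent (x a b : R) : x \in `]0, 1[ -> a != b ->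
  0 < H (x, b) - H (x, a) - D2 H (x, a) * (b - a).
Proof.
move=> x01; have [_ dH _] := H_C1; have [_ dDH _] := DpH_C1.
apply: (@strict_convex_tangent R (fun p => H (x, p)) (fun p => D2 H (x, p))
  (fun p => D2 (D2 H) (x, p))) => p.
- by apply: is_derive_D2; apply: diff_derivable; apply: dH; exact: strip_interior.
- by apply: is_derive_D2; apply: diff_derivable; apply: dDH; exact: strip_interior.
- by apply: DppH_gt0; exact: subset_itv_oo_cc.
Qed.

(** The slope is a parameter, so that it can be the continuous extension of u_x, meaningful on the
    boundary too. *)
Definition flux (m ux : R * R -> R) (z : R * R) : R := m z * D2 H (z.2, ux z).

(** The extensions of derivatives hidden in [Ck] become explicit arguments, and the equations are
    read along slices. The transport equation is the occurrence of [mt] as the x-derivative of the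
    flux. *)
Record regular_solution (u m ut ux mt : R * R -> R) : Prop := {
  reg_u : {within Omegabar T, continuous u};
  reg_m : {within Omegabar T, continuous m};
  reg_ut : {within Omegabar T, continuous ut};
  reg_mt : {within Omegabar T, continuous mt};
  reg_flux : {within Omegabar T, continuous (flux m ux)};
  reg_m_gt0 : forall z, Omegabar T z -> 0 < m z;
  reg_u_t : forall t x : R, Omega T (t, x) ->
    is_derive t 1 (fun s => u (s, x)) (ut (t, x));
  reg_u_x : forall t x : R, Omega T (t, x) ->
    is_derive x 1 (fun y => u (t, y)) (ux (t, x));
  reg_m_t : forall t x : R, Omega T (t, x) ->
    is_derive t 1 (fun s => m (s, x)) (mt (t, x));
  reg_flux_x : forall t x : R, Omega T (t, x) ->
    is_derive x 1 (fun y => flux m ux (t, y)) (mt (t, x));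
  reg_HJ : forall t x : R, Omega T (t, x) ->
    - ut (t, x) + H (x, ux (t, x)) = \int[mu]_(y in `[0, x]) m (t, y);
  reg_bdry : forall t : R, t \in `]0, T[ ->
    flux m ux (t, 0) = 0 /\ flux m ux (t, 1) = 0 }.

Lemma classical_solution_regular m0 mT u m :
  classical_solution T H m0 mT u m ->
  exists ut ux mt, regular_solution u m ut ux mt.
Proof.
case=> [[cu du gu] [cm dm gm] m_gt0 HJ tr _ _ bd].
have [ut [cut _ _] utE] := gu (1, 0).
have [ux [cux dux _] uxE] := gu (0, 1).
have [mt cmt mtE] := gm (1, 0).
have [_ dDH _] := DpH_C1; have [cDH _ _] := DpH_C1.
have cflux : {within Omegabar T, continuous (flux m ux)}.
  apply: continuous_withinM => //.
  apply: (continuous_within_comp (B := strip)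
    (g := fun z => (z.2, ux z)) (f := D2 H)) => //.
  - apply: continuous_within_pair => //.
    by apply: continuous_subspaceT => z; exact: cvg_snd.
  - by move=> z [_ z2]; split.
exists ut, ux, mt; split => //.
- move=> t x Oz; have Kz := Omega_interior Oz; rewrite utE//.
  by apply: is_derive_D1; exact/diff_derivable/du.
- move=> t x Oz; have Kz := Omega_interior Oz; rewrite uxE//.
  by apply: is_derive_D2; exact/diff_derivable/du.
- move=> t x Oz; have Kz := Omega_interior Oz; rewrite mtE//.
  by apply: is_derive_D1; exact/diff_derivable/dm.
- move=> t x Oz; have Kz := Omega_interior Oz.
  (* The transport equation only equates values of [D2], which is defined even where the quotient
     diverges. Derivability of the flux comes from the product and chain rules, using that u is C^2
     and that D_p H is C^1. *)
  have dflux : derivable (fun y => flux m ux (t, y)) x 1.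
    apply: derivableM.
      by have [] := is_derive_D2 (diff_derivable (dm _ Kz)).
    have duxx : differentiable (fun y => ux (t, y)) x.
      by apply/derivable1_diffP; have [] := is_derive_D2 (diff_derivable (dux _ Kz)).
    apply/derivable1_diffP.
    apply: (differentiable_comp (f := fun y => (y, ux (t, y))) (g := D2 H)).
      by apply: differentiable_pair.
    by apply: dDH; apply: strip_interior; case: Oz.
  apply: (DeriveDef dflux); rewrite -D2_derive mtE//.
  have /eqP := tr t x Oz; rewrite subr_eq0 => /eqP; rewrite /D1 => ->.
  (* The fluxes built from [ux] and from [D2 u] agree on the open set [Omega T], hence near the
     point. *)
  apply: near_eq_derive; apply: filterS (nbhs_Omega Oz) => w Ow.
  by rewrite /flux uxE//; exact: Omega_interior.
- move=> t x Oz; have Kz := Omega_interior Oz.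
  by rewrite -HJ// utE// uxE.
- have bdry (t x : R) : t \in `]0, T[ -> x = 0 \/ x = 1 -> flux m ux (t, x) = 0.
    move=> tT x01; have := bd t x tT x01.
    rewrite (@trace_eq _ T T_gt0 ux) ?mulNr//.
    + by move/eqP; rewrite oppr_eq0 => /eqP.
    + by move=> z Oz; rewrite uxE//; exact: Omega_interior.
    + split; first exact: subset_itv_oo_cc.
      by case: x01 => ->; rewrite /itv01/= in_itv/= lexx ler01.
  by move=> t tT; split; apply: bdry => //; [left|right].
Qed.

End Solution.

(** * Comparison of two solutions *)

Section Uniqueness.
Context {R : realType}.
Local Notation mu := (@lebesgue_measure R).
Variables (T : R) (H : R * R -> R).
Hypothesis T_gt0 : 0 < T.
Hypothesis H_C1 : Ck 1 strip H.
Hypothesis DpH_C1 : Ck 1 strip (D2 H).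
Hypothesis DppH_gt0 :
  forall x : R, itv01 x -> forall p : R, 0 < D2 (D2 H) (x, p).
Variables (u1 m1 u2 m2 ut1 ux1 mt1 ut2 ux2 mt2 : R * R -> R).
Hypothesis sol1 : regular_solution T H u1 m1 ut1 ux1 mt1.
Hypothesis sol2 : regular_solution T H u2 m2 ut2 ux2 mt2.
Hypothesis m_ends : forall x : R, x \in `[0, 1] ->
  m1 (0, x) = m2 (0, x) /\ m1 (T, x) = m2 (T, x).

Let du z := u1 z - u2 z.
Let dm z := m1 z - m2 z.
Let dut z := ut1 z - ut2 z.
Let dux z := ux1 z - ux2 z.
Let dmt z := mt1 z - mt2 z.
Let dq z := flux H m1 ux1 z - flux H m2 ux2 z.
Let dw (t x : R) := \int[mu]_(y in `[0, x]) dm (t, y).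

Let cdu : {within Omegabar T, continuous du}.
Proof. exact: continuous_withinB (reg_u sol1) (reg_u sol2). Qed.
Let cdm : {within Omegabar T, continuous dm}.
Proof. exact: continuous_withinB (reg_m sol1) (reg_m sol2). Qed.
Let cdut : {within Omegabar T, continuous dut}.
Proof. exact: continuous_withinB (reg_ut sol1) (reg_ut sol2). Qed.
Let cdmt : {within Omegabar T, continuous dmt}.
Proof. exact: continuous_withinB (reg_mt sol1) (reg_mt sol2). Qed.
Let cdq : {within Omegabar T, continuous dq}.
Proof. exact: continuous_withinB (reg_flux sol1) (reg_flux sol2). Qed.

Let du_t (t x : R) : Omega T (t, x) ->
  is_derive t 1 (fun s => du (s, x)) (dut (t, x)).
Proof.
by move=> Oz; apply: is_deriveB; [exact: (reg_u_t sol1)|exact: (reg_u_t sol2)].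
Qed.

Let du_x (t x : R) : Omega T (t, x) ->
  is_derive x 1 (fun y => du (t, y)) (dux (t, x)).
Proof.
by move=> Oz; apply: is_deriveB; [exact: (reg_u_x sol1)|exact: (reg_u_x sol2)].
Qed.

Let dm_t (t x : R) : Omega T (t, x) ->
  is_derive t 1 (fun s => dm (s, x)) (dmt (t, x)).
Proof.
by move=> Oz; apply: is_deriveB; [exact: (reg_m_t sol1)|exact: (reg_m_t sol2)].
Qed.

Let dq_x (t x : R) : Omega T (t, x) ->
  is_derive x 1 (fun y => dq (t, y)) (dmt (t, x)).
Proof.
by move=> Oz; apply: is_deriveB; [exact: (reg_flux_x sol1)|exact: (reg_flux_x sol2)].
Qed.

Let slice (f : R * R -> R) (t : R) : {within Omegabar T, continuous f} ->
  t \in `]0, T[ -> {within `[0, 1], continuous (fun x => f (t, x))}.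
Proof.
by move=> cf tT; apply: continuous_slice_x cf _; exact: subset_itv_oo_cc.
Qed.

Let dw_x (t x : R) : Omega T (t, x) ->
  is_derive x 1 (dw t) (dm (t, x)).
Proof.
by move=> [tT x01]; exact: (is_derive_primitive01 (slice cdm tT) x01).
Qed.

Let dq_bdry (t : R) : t \in `]0, T[ -> dq (t, 0) = 0 /\ dq (t, 1) = 0.
Proof.
move=> tT; have [p0 p1] := reg_bdry sol1 tT; have [q0 q1] := reg_bdry sol2 tT.
by rewrite /dq p0 p1 q0 q1 subrr.
Qed.

Let dm_ends (x : R) : x \in `[0, 1] -> dm (0, x) = 0 /\ dm (T, x) = 0.
Proof. by move=> /m_ends[]; rewrite /dm => -> ->; rewrite !subrr. Qed.

Let dw0 (t : R) : dw t 0 = 0.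
Proof. by rewrite /dw set_itv1 Rintegral_set1. Qed.

(** Conservation of mass: the balance lemma with f = [dm], h = [dq] and g = k = [dmt]. *)
Let dw1 (t : R) : t \in `]0, T[ -> dw t 1 = 0.
Proof.
move=> tT.
have q01 (s : R) : s \in `]0, T[ -> dq (s, 0) = dq (s, 1).
  by move=> /dq_bdry[-> ->].
have [+ _] := balance_rigidity (h := dq) T_gt0 cdm cdmt dm_t
  (fun t => slice cdq) dq_x (fun z _ => lexx _) q01 dm_ends.
by apply; exact: subset_itv_oo_cc.
Qed.

Let HJ (t x : R) : Omega T (t, x) ->
  - dut (t, x) + (H (x, ux1 (t, x)) - H (x, ux2 (t, x))) = dw t x.
Proof.
move=> Oz; have [tT x01] := Oz; rewrite /dw RintegralB//.
- rewrite -(reg_HJ sol1 Oz) -(reg_HJ sol2 Oz) /dut; ring.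
- apply: integrableS (integrable_continuous01 (slice (reg_m sol1) tT)) => //.
  apply: subset_itvl; rewrite bnd_simp.
  by move: x01; rewrite /= in_itv/= => /andP[_ /ltW].
- apply: integrableS (integrable_continuous01 (slice (reg_m sol2) tT)) => //.
  apply: subset_itvl; rewrite bnd_simp.
  by move: x01; rewrite /= in_itv/= => /andP[_ /ltW].
Qed.

(** The Bregman distances of H(x, .) between the two slopes, taken in both orders and weighted by
    the two densities. *)
Let defect z : R :=
  m1 z * (H (z.2, ux2 z) - H (z.2, ux1 z) - D2 H (z.2, ux1 z) * (ux2 z - ux1 z)) +
  m2 z * (H (z.2, ux1 z) - H (z.2, ux2 z) - D2 H (z.2, ux2 z) * (ux1 z - ux2 z)).

Let defect_gt0 z : Omega T z -> ux1 z != ux2 z -> 0 < defect z.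
Proof.
move=> Oz pq; have Kz := Omega_sub_closed Oz.
have z01 : z.2 \in `]0, 1[ by case: Oz.
have tangent a b := Hamiltonian_tangent H_C1 DpH_C1 DppH_gt0 (a := a) (b := b) z01.
rewrite /defect; apply: addr_gt0; apply: mulr_gt0.
- exact: (reg_m_gt0 sol1).
- exact: tangent.
- exact: (reg_m_gt0 sol2).
- by apply: tangent; rewrite eq_sym.
Qed.

Let defect_ge0 z : Omega T z -> 0 <= defect z.
Proof.
move=> Oz; have [pq|pq] := eqVneq (ux1 z) (ux2 z); last by rewrite ltW// defect_gt0.
by rewrite /defect pq !subrr !mulr0 subrr !mulr0 addr0.
Qed.

Let ux_eq z : Omega T z -> ux1 z = ux2 z.
Proof.
pose f z := du z * dm z.
pose g z := dut z * dm z + du z * dmt z.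
pose h z := du z * dq z - dw z.1 z.2 * dw z.1 z.2 / 2.
pose k z := dux z * dq z + du z * dmt z - dw z.1 z.2 * dm z.
(* Substituting the difference of the Hamilton-Jacobi equations for [dw] in [k] produces the term
   [dut * dm] of [g]. What remains, [dux * dq] minus [dm] times the difference of the Hamiltonians,
   is exactly [defect]. *)
have gkE y : Omega T y -> g y = k y - defect y.
  case: y => t x Oy; have E := HJ Oy.
  rewrite /g /k /defect /= -E /dux /dq /flux /dut /dm /=; ring.
have [_ gk] :
  (forall t : R, t \in `[0, T] -> \int[mu]_(x in `[0, 1]) f (t, x) = 0) /\
  (forall z, Omega T z -> g z = k z).
  apply: (@balance_rigidity R T T_gt0 f g h k).
  - exact: continuous_withinM.
  - by apply: continuous_withinD; exact: continuous_withinM.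
  - move=> t x Oy; apply: (is_derive_eq (is_deriveM (du_t Oy) (dm_t Oy))).
    by rewrite /g /GRing.scale/=; ring.
  - move=> t tT; apply: continuous_withinB.
      by apply: continuous_withinM; exact: slice.
    have cw : {within `[0, 1], continuous (dw t)}.
      by apply: continuous_primitive01; exact: slice.
    apply: continuous_withinM; first exact: continuous_withinM.
    by apply: continuous_subspaceT => ?; exact: cvg_cst.
  - move=> t x Oy.
    have d1 := is_deriveM (du_x Oy) (dq_x Oy).
    have d2 := is_deriveM (is_deriveM (dw_x Oy) (dw_x Oy)) (is_derive_cst (2^-1 : R) x 1).
    apply: (is_derive_eq (is_deriveB d1 d2)).
    by rewrite /k /GRing.scale/=; field.
  - by move=> y Oy; rewrite gkE// gerBl defect_ge0.
  - move=> t tT; have [q0 q1] := dq_bdry tT.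
    by rewrite /h /= q0 q1 dw0 dw1// !mulr0.
  - by move=> x x01; have [d0 dT] := dm_ends x01; rewrite /f d0 dT !mulr0.
move=> Oz; apply/eqP/negPn/negP => /(defect_gt0 Oz).
(* Equality of g and k forces [defect z = 0], against its positivity when the slopes differ. *)
have /eqP := gkE z Oz.
by rewrite gk// eq_sym subr_eq addrC -subr_eq subrr => /eqP <-; rewrite ltxx.
Qed.

Let du_const_x (t x y : R) : t \in `]0, T[ -> x \in `[0, 1] -> y \in `[0, 1] ->
  du (t, x) = du (t, y).
Proof.
move=> tT.
have d0 (s : R) : s \in `]0, 1[ -> is_derive s 1 (fun x => du (t, x)) 0.
  move=> s01; have Oz : Omega T (t, s) by [].
  by have := du_x Oz; rewrite /dux ux_eq// subrr.
have E := derive0_constant (slice cdu tT) d0.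
by move=> x01 y01; rewrite (E x x01) (E y y01).
Qed.

Let dut_const (t x y : R) : Omega T (t, x) -> Omega T (t, y) ->
  dut (t, x) = dut (t, y).
Proof.
move=> Ox Oy; have [_ <-] := du_t Ox; have [_ <-] := du_t Oy.
apply: near_eq_derive; have [tT x01] := Ox; have [_ y01] := Oy.
near=> s; apply: du_const_x; [|exact: subset_itv_oo_cc..].
by near: s; exact: near_in_itvoo.
Unshelve. all: by end_near. Qed.

Let dwE (t x : R) : Omega T (t, x) -> dw t x = - dut (t, x).
Proof. by move=> Oz; rewrite -HJ// ux_eq// subrr addr0. Qed.

(** Near x, [dw t] equals [- dut], which does not depend on x, so its derivative [dm] is zero. *)
Let dm0 z : Omega T z -> dm z = 0.
Proof.
case: z => t x Oz; have [_ <-] := dw_x Oz; have [tT x01] := Oz.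
rewrite (near_eq_derive (g := cst (- dut (t, x)))) ?derive_cst//.
near=> y; have Oy : Omega T (t, y) by split => //; near: y; exact: near_in_itvoo.
by rewrite dwE// (dut_const Oy Oz).
Unshelve. all: by end_near. Qed.

Lemma mass_unique z : Omegabar T z -> m1 z = m2 z.
Proof.
apply: (eq_on_Omegabar T_gt0 (reg_m sol1) (reg_m sol2)) => y /dm0 /eqP.
by rewrite subr_eq0 => /eqP.
Qed.

(** Equal densities make the coupling difference [dw] vanish, and [dw] is [- dut]. *)
Let dut0 z : Omega T z -> dut z = 0.
Proof.
case: z => t x Oz; apply/eqP; rewrite -oppr_eq0 -dwE//; apply/eqP.
rewrite /dw (@eq_Rintegral _ _ _ mu _ (cst 0)) ?Rintegral_cst ?mul0r//.
move=> y /[!inE]/=; rewrite in_itv/= => /andP[y0 yx].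
rewrite /dm mass_unique ?subrr//.
have [tT] := Oz; rewrite /= in_itv/= => /andP[_ x1].
by split; [exact: subset_itv_oo_cc|rewrite /itv01/= in_itv/= y0 (le_trans yx)// ltW].
Qed.

Lemma value_unique : exists c, forall z, Omegabar T z -> u1 z - u2 z = c.
Proof.
(* A reference abscissa inside (0, 1), where [dut] is known to vanish. *)
pose a : R := 2^-1.
have a01 : a \in `]0, 1[ by rewrite in_itv/= invr_gt0 ltr0n invf_lt1 ?ltr1n.
have a01' : a \in `[0, 1] by exact: subset_itv_oo_cc.
(* Independence of x holds at interior points and passes to the closed rectangle, including t = 0
   and t = T, by continuity. *)
have duE z : Omegabar T z -> du z = du (z.1, a).
  move: z; apply: (@eq_on_Omegabar _ T T_gt0 du (fun z => du (z.1, a)) cdu).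
    apply: (continuous_within_comp (B := Omegabar T)
      (g := fun z => (z.1, a)) (f := du)) => //.
    + apply: continuous_within_pair; apply: continuous_subspaceT => w.
        exact: cvg_fst.
      exact: cvg_cst.
    + by move=> w [].
  by move=> [t x] [tT x01]; apply: du_const_x => //; exact: subset_itv_oo_cc.
exists (du (0, a)) => z Kz; rewrite -[LHS]/(du z) duE//.
apply: (derive0_constant (continuous_slice_t cdu a01')); last by case: Kz.
by move=> t tT; have Oz : Omega T (t, a) by []; rewrite -(dut0 Oz); exact: du_t.
Qed.

End Uniqueness.

(** * Uniqueness for the planning problem *)

Unset Implicit Arguments.

Theorem corollary1p3 (R : realType) (T : R) (T_gt0 : 0 < T)
  (H : R * R -> R)
  (H_C1 : Ck 1 strip H)
  (DpH_C1 : Ck 1 strip (D2 H))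
  (H_superlinear : forall x : R, itv01 x ->
     (H (x, p) / `|p| @[p --> +oo] --> +oo) /\
     (H (x, p) / `|p| @[p --> -oo] --> +oo))
  (DppH_gt0 : forall x : R, itv01 x -> forall p : R, 0 < D2 (D2 H) (x, p))
  (m0 mT : R -> R)
  (m0_C1 : Ck 1 itv01 m0) (mT_C1 : Ck 1 itv01 mT)
  (m0_gt0 : forall x : R, itv01 x -> 0 < m0 x)
  (mT_gt0 : forall x : R, itv01 x -> 0 < mT x)
  (m0_int1 : \int[lebesgue_measure]_(x in itv01) m0 x = 1)
  (mT_int1 : \int[lebesgue_measure]_(x in itv01) mT x = 1)
  (u1 m1 u2 m2 : R * R -> R)
  (sol1 : classical_solution T H m0 mT u1 m1)
  (sol2 : classical_solution T H m0 mT u2 m2) :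
  (forall z, Omegabar T z -> m1 z = m2 z) /\
  exists c : R, forall z, Omegabar T z -> u1 z - u2 z = c.
Proof.
have [ut1 [ux1 [mt1 reg1]]] := classical_solution_regular T_gt0 DpH_C1 sol1.
have [ut2 [ux2 [mt2 reg2]]] := classical_solution_regular T_gt0 DpH_C1 sol2.
(* The planning data fix the density at both end times and leave u free there. This makes the
   product [du * dm] vanish at t = 0 and t = T. *)
have m_ends (x : R) : x \in `[0, 1] ->
    m1 (0, x) = m2 (0, x) /\ m1 (T, x) = m2 (T, x).
  move=> x01; rewrite (sol_init sol1)// (sol_init sol2)//.
  by rewrite (sol_final sol1)// (sol_final sol2).
split.
  exact: (mass_unique T_gt0 H_C1 DpH_C1 DppH_gt0 reg1 reg2 m_ends).
exact: (value_unique T_gt0 H_C1 DpH_C1 DppH_gt0 reg1 reg2 m_ends).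
Qed.
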